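(* Every finitely generated subgroup of a strongly (D)CI$_f$-group is a (D)CI$_f$-group.
   Context: For a group $G$ and a subset $S\subseteq G\setminus\{e\}$, the Cayley digraph $\mathrm{Cay}(G;S)$ has vertex set $G$ and an arc from $g$ to $gs$ for all $g\in G$, $s\in S$; if $S=S^{-1}$ it is regarded as an undirected Cayley graph. The digraph $\mathrm{Cay}(G;S)$ is a DCI-graph if whenever $S'\subseteq G\setminus\{e\}$ and $\mathrm{Cay}(G;S)\cong\mathrm{Cay}(G;S')$ as digraphs, there is a group automorphism $\alpha$ of $G$ with $\alpha(S)=S'$. An undirected Cayley graph (so $S=S^{-1}$) is a CI-graph if the same holds for all $S'=S'^{-1}$. A group $G$ is a strongly (D)CI$_f$-group if every locally finite Cayley (di)graph $\mathrm{Cay}(G;S)$ on $G$ (i.e. $S$ finite, not necessarily generating) is a (D)CI-graph. A finitely generated group $G$ is a (D)CI$_f$-group if every connected locally finite Cayley (di)graph $\mathrm{Cay}(G;S)$ on $G$ (i.e. $S$ finite and $\langle S\rangle=G$) is a (D)CI-graph; a digraph is called connected if its underlying undirected graph is. The notation ''(D)CI'' means that the statement holds in two versions: for undirected graphs with ''CI'' throughout, and for digraphs with ''DCI'' throughout. *)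

(* Defs.v *)
From HB Require Import structures.
From mathcomp Require Import all_boot.
From mathcomp Require Import boolp classical_sets functions cardinality.

Set Implicit Arguments.
Unset Strict Implicit.
Unset Printing Implicit Defensive.

Local Open Scope classical_set_scope.
Local Open Scope group_scope.

Section Digraph.
Variables U V : Type.
Implicit Types (R : U -> U -> Prop) (Q : V -> V -> Prop).

Definition digraph_iso R Q : Prop :=
  exists2 f : U -> V, bijective f & forall x y, R x y <-> Q (f x) (f y).

Definition locally_finite R : Prop :=
  forall x, finite_set [set y | R x y] /\ finite_set [set y | R y x].

(* The endpoints of a walk that may traverse arcs in either direction. *)
Inductive walk R : U -> U -> Prop :=
| walk_refl x : walk R x x
| walk_step x y z : walk R x y -> R y z \/ R z y -> walk R x z.

Definition connected R : Prop := forall x y, walk R x y.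

End Digraph.

Section Cayley.
Variable G : groupType.
Implicit Types S T : set G.

Definition Cay S : G -> G -> Prop := fun g h => exists2 s, S s & h = g * s.

Definition inv_set S : set G := (fun x => x^-1) @` S.

Definition subgroup_gen S : set G :=
  smallest (fun A : set G => group_closed [in A]) S.

Definition fin_generated : Prop :=
  exists2 S : set G, finite_set S & subgroup_gen S = setT.

Definition DCI_graph S : Prop :=
  forall T, ~ T 1 -> digraph_iso (Cay S) (Cay T) ->
  exists2 alpha : {multiplicative G -> G}, bijective alpha & alpha @` S = T.

Definition CI_graph S : Prop :=
  forall T, ~ T 1 -> inv_set T = T -> digraph_iso (Cay S) (Cay T) ->
  exists2 alpha : {multiplicative G -> G}, bijective alpha & alpha @` S = T.

Definition strongly_DCIf : Prop :=
  forall S, ~ S 1 -> locally_finite (Cay S) -> DCI_graph S.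

Definition strongly_CIf : Prop :=
  forall S, ~ S 1 -> inv_set S = S -> locally_finite (Cay S) -> CI_graph S.

Definition DCIf : Prop :=
  fin_generated /\
  forall S, ~ S 1 -> connected (Cay S) -> locally_finite (Cay S) ->
  DCI_graph S.

Definition CIf : Prop :=
  fin_generated /\
  forall S, ~ S 1 -> inv_set S = S ->
  connected (Cay S) -> locally_finite (Cay S) -> CI_graph S.

Lemma locally_finite_Cay S : locally_finite (Cay S) <-> finite_set S.
Proof.
split=> [/(_ 1) [fS _]|fS g].
  by apply: sub_finite_set fS => s Ss; exists s; rewrite ?mul1g.
split.
  apply: sub_finite_set (finite_image (fun s => g * s) fS).
  by move=> _ [s Ss ->]; exists s.
apply: sub_finite_set (finite_image (fun s => g * s^-1) fS).
by move=> h [s Ss ->]; exists s => //; rewrite mulgK.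
Qed.

Lemma sub_subgroup_gen S : S `<=` subgroup_gen S.
Proof. by move=> x Sx A [_]; apply. Qed.

Lemma subgroup_gen_closed S : group_closed [in subgroup_gen S].
Proof.
split; first by rewrite inE => A [[/[!inE] ? _] _].
move=> x y /set_mem Sx /set_mem Sy; apply/mem_set => A cA.
have [[_ dA] _] := cA.
by apply/set_mem/dA; apply/mem_set; [apply: Sx | apply: Sy].
Qed.

Lemma connected_Cay S : connected (Cay S) <-> subgroup_gen S = setT.
Proof.
have clS := subgroup_gen_closed S.
split=> [cS|genS x y].
  apply/seteqP; split=> // x _.
  have: (1 : G) \in subgroup_gen S by case: clS.
  elim: (cS 1 x) => [z /set_mem //|a b c _ IH step a1].
  have /mem_set Sb := IH a1.
  case: step => [] [s /sub_subgroup_gen/mem_set Ss e]; apply/set_mem.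
    by rewrite e; apply: (group_closedM clS).
  by have := (proj2 clS) _ _ Sb Ss; rewrite e mulgK.
have walk_gen : group_closed [in [set z | forall g, walk (Cay S) g (g * z)]].
  split; first by rewrite inE => g; rewrite mulg1; apply: walk_refl.
  move=> a b /set_mem /= wa /set_mem /= wb; apply/mem_set => /= g.
  have wtrans u v w : walk (Cay S) v w -> walk (Cay S) u v ->
      walk (Cay S) u w.
    by elim=> // p q r _ IH st /IH up; apply: walk_step st.
  have wsym u v : walk (Cay S) u v -> walk (Cay S) v u.
    elim=> [p|p q r _ IH st]; first exact: walk_refl.
    by apply: wtrans IH _; apply: (walk_step (walk_refl _ r)); case: st; tauto.
  rewrite mulgA; apply: wtrans (wa g); apply: wsym.
  by have := wb (g * a * b^-1); rewrite mulgVK.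
have: subgroup_gen S (x^-1 * y) by rewrite genS.
move=> /(_ _ (conj walk_gen _)) /= h.
have -> : y = x * (x^-1 * y) by rewrite mulVKg.
apply: h => s Ss g; apply: walk_step (walk_refl _ _) _.
by left; exists s.
Qed.

End Cayley.

(* A subgroup of G is any [H : subGroupType P], a group structure inherited
   from G on the subtype of a boolean predicate P; by excluded middle no
   subgroup is lost. *)
Section Subgroup.
Variables (G : groupType) (A : set G).
Hypothesis cA : group_closed [in A].

Let H : Type := {x : G | x \in A}.
HB.instance Definition _ := SubChoice.on H.
HB.instance Definition _ := SubChoice_isSubGroup.Build G [in A] H cA.

Lemma subGroupType_ex :
  exists (P : pred G) (K : subGroupType P), range (val : K -> G) = A.
Proof.
exists [in A], H; apply/seteqP; split=> [_ [x _ <-]|x Ax].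
  exact/set_mem/(valP x).
by exists (Sub x (mem_set Ax)); rewrite ?SubK.
Qed.

End Subgroup.

(* Main.v *)
Require Import Defs.
From mathcomp Require Import all_boot.
From HB Require Import structures.
From mathcomp Require Import boolp classical_sets.

(** Let [H] be a subgroup of [G] and let [S] generate [H].

    Choosing a representative in every left coset of [H] identifies [G] with
    (cosets) x [H], and in these coordinates the arcs of the Cayley digraph of
    [S] on [G] never leave a coset and restrict on each one to a copy of the
    Cayley digraph of [S] on [H] ([Cay_val]).  An isomorphism
    Cay(H; S) -> Cay(H; T) can therefore be applied in all the cosets at once,
    giving Cay(G; S) ~ Cay(G; T) ([digraph_iso_Cay_val]).

    The CI property of [S] in [G] now provides an automorphism of [G] that
    carries [S] to [T].  Connectedness is invariant under isomorphism, so [T]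
    generates [H] as well; hence the automorphism carries [H] = <S> onto
    <T> = [H], and its restriction to [H] is the automorphism sought
    ([restrict_automorphism]).  Both versions of the statement follow, as the
    passage from [H] to [G] preserves finiteness and symmetry of [S] and
    [T]. *)

Set Implicit Arguments.
Unset Strict Implicit.
Unset Printing Implicit Defensive.

Local Open Scope classical_set_scope.
Local Open Scope group_scope.

Lemma connected_digraph_iso (U V : Type) (R : U -> U -> Prop)
    (Q : V -> V -> Prop) :
  digraph_iso R Q -> connected R -> connected Q.
Proof.
move=> [f [g _ gK] fP] cR x y; rewrite -(gK x) -(gK y).
elim: (cR (g x) (g y)) => [z|a b c _ IH st]; first exact: walk_refl.
by apply: walk_step IH _; case: st => /fP; [left | right].
Qed.

Lemma subgroup_gen_min (G : groupType) (S A : set G) :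
  group_closed [in A] -> S `<=` A -> subgroup_gen S `<=` A.
Proof. by move=> cA SA x; apply. Qed.

Lemma multiplicative_of_morph (G K : groupType) (f : G -> K) :
  {morph f : x y / x * y} ->
  exists phi : {multiplicative G -> K}, (phi : G -> K) = f.
Proof.
move=> fM; pose m := isMultiplicative.Build G K f fM.
by exists (HB.pack_for {multiplicative G -> K} f m).
Qed.

Lemma multiplicative1 (G K : groupType) (phi : {multiplicative G -> K}) :
  phi 1 = 1.
Proof. by apply: (mulgI (phi 1)); rewrite -gmulfM !mulg1. Qed.

Lemma multiplicativeF (G K : groupType) (phi : {multiplicative G -> K}) :
  {morph phi : x y / x * y^-1}.
Proof. by move=> x y; apply: (mulIg (phi y)); rewrite -gmulfM !mulgVK. Qed.

Section Subgroup.
Variables (G : groupType) (P : pred G) (H : subGroupType P).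
Implicit Types (S T : set H) (g : G) (h : H).

Lemma subgroup1 : P 1.
Proof. by rewrite -(val1 H) valP. Qed.

Lemma subgroupM x y : P x -> P y -> P (x * y).
Proof. by move=> Px Py; rewrite -(SubK H Px) -(SubK H Py) -valM valP. Qed.

Lemma subgroupV x : P x -> P x^-1.
Proof. by move=> Px; rewrite -(SubK H Px) -gmulfV valP. Qed.

Lemma subgroupMr x h : P (x * val h) = P x.
Proof.
apply/idP/idP => [Pxh|Px]; last exact: subgroupM (valP h).
by rewrite -(mulgK (val h) x); apply/subgroupM/subgroupV/valP.
Qed.

(** [choose] depends only on the predicate, which is the same for all elements
    of a coset: this is what makes the representative well defined. *)
Definition coset_rep g : G := choose (fun x => P (x^-1 * g)) g.

Definition coset_coord g : H := insubd 1 ((coset_rep g)^-1 * g).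

Lemma coset_repP g : P ((coset_rep g)^-1 * g).
Proof.
by apply: (@chooseP _ (fun x => P (x^-1 * g))); rewrite mulVg subgroup1.
Qed.

Lemma coset_repK g : coset_rep g * val (coset_coord g) = g.
Proof. by rewrite insubdK ?mulVKg //; apply: coset_repP. Qed.

Lemma coset_repM g h : coset_rep (g * val h) = coset_rep g.
Proof.
rewrite /coset_rep.
have -> : (fun x => P (x^-1 * (g * val h))) = (fun x => P (x^-1 * g)).
  by apply: functional_extensionality_dep => x; rewrite mulgA subgroupMr.
by apply: (@choose_id _ (fun x => P (x^-1 * g)));
  rewrite ?mulVg ?subgroup1 // -(subgroupMr _ h) -mulgA mulVg subgroup1.
Qed.

Lemma coset_repMrep g h : coset_rep (coset_rep g * val h) = coset_rep g.
Proof.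
rewrite coset_repM -[in RHS](coset_repK g).
by rewrite coset_repM.
Qed.

Lemma coset_coordMrep g h : coset_coord (coset_rep g * val h) = h.
Proof. by apply: val_inj; apply: (mulgI (coset_rep g));
  rewrite -{1}(coset_repMrep g h) coset_repK. Qed.

Lemma coset_coordM g h : coset_coord (g * val h) = coset_coord g * h.
Proof.
apply: val_inj; apply: (mulgI (coset_rep g)).
by rewrite -{1}(coset_repM g h) coset_repK valM mulgA coset_repK.
Qed.

(** The Cayley digraph of [S] on [G] is a disjoint union of copies, indexed by
    the cosets, of the one on [H]. *)
Lemma Cay_val S g g' :
  Cay (val @` S : set G) g g' <->
  coset_rep g' = coset_rep g /\ Cay S (coset_coord g) (coset_coord g').
Proof.
split=> [[_ [s Ss <-] ->]|[e [s Ss c]]].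
  by rewrite coset_repM; split=> //; exists s => //; rewrite coset_coordM.
exists (val s); first by exists s.
by rewrite -(coset_repK g') c e valM mulgA coset_repK.
Qed.

Lemma digraph_iso_Cay_val S T :
  digraph_iso (Cay S) (Cay T) ->
  digraph_iso (Cay (val @` S : set G)) (Cay (val @` T : set G)).
Proof.
move=> [f [f' fK f'K] fP].
pose ext (k : H -> H) g := coset_rep g * val (k (coset_coord g)).
have extK k k' : cancel k k' -> cancel (ext k) (ext k').
  by move=> kK g; rewrite /ext coset_repMrep coset_coordMrep kK coset_repK.
exists (ext f); first by exists (ext f'); apply: extK.
move=> g g'; split=> /Cay_val.
  by move=> [e /fP a]; apply/Cay_val; rewrite !coset_repMrep !coset_coordMrep.
by rewrite !coset_repMrep !coset_coordMrep => -[e /fP a]; apply/Cay_val.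
Qed.

Lemma sub_gmul_gen S (phi : {multiplicative G -> G}) :
  subgroup_gen S = setT -> (forall s, S s -> P (phi (val s))) ->
  forall h, P (phi (val h)).
Proof.
move=> genS phiS h; have : subgroup_gen S h by rewrite genS.
apply: (@subgroup_gen_min _ S [set k : H | P (phi (val k))]) => //.
split=> [|x y /set_mem /= Px /set_mem /= Py]; apply/mem_set => /=.
  by rewrite val1 multiplicative1 subgroup1.
by rewrite valM gmulfV multiplicativeF; apply/subgroupM/subgroupV.
Qed.

(** Surjectivity of the restriction comes from [T] generating [H]: in general
    an automorphism of [G] may map [H] onto a proper subgroup of [H], but here
    the inverse automorphism also preserves [H], because it maps the generators
    [T] into [H]. *)
Lemma restrict_automorphism S T (alpha : {multiplicative G -> G}) :
  subgroup_gen S = setT -> subgroup_gen T = setT ->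
  bijective alpha -> alpha @` (val @` S) = val @` T ->
  exists2 beta : {multiplicative H -> H}, bijective beta & beta @` S = T.
Proof.
move=> genS genT [a' aK a'K] aST.
have aS s : S s -> exists2 t, T t & val t = alpha (val s).
  move=> Ss; have : (val @` T : set G) (alpha (val s)).
    by rewrite -aST; exists (val s) => //; exists s.
  by case=> t Tt <-; exists t.
have aT t : T t -> exists2 s, S s & alpha (val s) = val t.
  move=> Tt; have : (alpha @` (val @` S) : set G) (val t).
    by rewrite aST; exists t.
  by case=> _ [s Ss <-] e; exists s.
have [alpha' a'E] := multiplicative_of_morph (can2_gmulfM aK a'K).
have Pa h : P (alpha (val h)).
  by apply: (sub_gmul_gen genS) => s /aS[t _ <-]; apply: valP.
have Pa' h : P (a' (val h)).
  rewrite -a'E; apply: (sub_gmul_gen genT) => t /aT[s _ <-].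
  by rewrite a'E aK; apply: valP.
pose b h : H := Sub _ (Pa h); pose b' h : H := Sub _ (Pa' h).
have bM : {morph b : x y / x * y}.
  by move=> x y; apply: val_inj; rewrite valM !SubK valM gmulfM.
have [beta betaE] := multiplicative_of_morph bM.
exists beta; rewrite betaE.
  by exists b' => h; apply: val_inj; rewrite !SubK ?aK ?a'K.
apply/seteqP; split=> [_ [s /aS[t Tt e] <-]|t /aT[s Ss e]].
  by have -> : b s = t by apply: val_inj; rewrite SubK.
by exists s => //; apply: val_inj; rewrite SubK.
Qed.

Lemma automorphism_of_val S T :
  connected (Cay S) -> digraph_iso (Cay S) (Cay T) ->
  (exists2 alpha : {multiplicative G -> G},
    bijective alpha & alpha @` (val @` S) = val @` T) ->
  exists2 beta : {multiplicative H -> H}, bijective beta & beta @` S = T.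
Proof.
move=> cS iST [alpha bij_alpha aST].
have cT := connected_digraph_iso iST cS.
by apply: restrict_automorphism bij_alpha aST; apply/connected_Cay.
Qed.

Lemma val_not1 S : ~ S 1 -> ~ (val @` S : set G) 1.
Proof.
by move=> S1 [s Ss e]; apply: S1; rewrite -(val_inj (etrans e (esym (val1 H)))).
Qed.

Lemma inv_set_val S :
  inv_set S = S -> inv_set (val @` S : set G) = val @` S.
Proof.
move=> SV; rewrite /inv_set -[in RHS]SV !image_comp.
by apply: eq_imagel => s _ /=; rewrite gmulfV.
Qed.

Lemma locally_finite_Cay_val S :
  locally_finite (Cay S) -> locally_finite (Cay (val @` S : set G)).
Proof.
move=> /locally_finite_Cay fS; apply/locally_finite_Cay.
exact: cardinality.finite_image.
Qed.

End Subgroup.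

Theorem proposition3p6 (G : groupType) (P : pred G) (H : subGroupType P) :
  fin_generated H ->
  (strongly_CIf G -> CIf H) /\ (strongly_DCIf G -> DCIf H).
Proof.
move=> fgH; split=> ciG; split=> // S S1.
- move=> SV cS lfS T T1 TV iST; apply: (automorphism_of_val cS iST).
  apply: ciG (digraph_iso_Cay_val iST); first exact: val_not1.
  + exact: inv_set_val.
  + exact: locally_finite_Cay_val.
  + exact: val_not1.
  + exact: inv_set_val.
- move=> cS lfS T T1 iST; apply: (automorphism_of_val cS iST).
  apply: ciG (digraph_iso_Cay_val iST); first exact: val_not1.
  + exact: locally_finite_Cay_val.
  + exact: val_not1.
Qed.
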